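(* Let $\mu=\sum_{n=0}^\infty\mu(n)\delta_n$ be the dilogarithm distribution, i.e. the probability on $\mathbb{N}=\{0,1,2,\ldots\}$ defined by $$\sum_{n=0}^{\infty}\mu(n)z^n=\exp\Big(\sum_{n=1}^{\infty}\frac{z^n-1}{n^2}\Big),\qquad |z|\le 1.$$ Then $\mu$ is a dual measure of itself.
   Context: For a positive measure $\mu$ on $\mathbb{R}$ let $B_\mu(s)=\int_{\mathbb{R}}e^{-sx}\mu(dx)$, let $S(\mu)$ be the interior of $\{s: B_\mu(s)<\infty\}$, and $\ell_\mu=\log B_\mu$. $\mathcal{M}(\mathbb{R})$ is the set of positive measures on $\mathbb{R}$ not concentrated on one point and with $S(\mu)\neq\emptyset$. Put $M_{F(\mu)}=-\ell'_\mu(S(\mu))$. A measure $\mu^*\in\mathcal{M}(\mathbb{R})$ is a dual measure of $\mu\in\mathcal{M}(\mathbb{R})$ if $M_{F(\mu)}\subset S(\mu^* )$ and $-\ell'_{\mu^*}(-\ell'_\mu(s))=s$ for all $s\in S(\mu)$. *)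

(* Defs.v *)
From HB Require Import structures.
From mathcomp Require Import all_boot all_order all_algebra.
From mathcomp Require Import all_classical all_reals all_analysis.

Set Implicit Arguments.
Unset Strict Implicit.
Unset Printing Implicit Defensive.

Import Order.TTheory GRing.Theory Num.Theory.
Import numFieldNormedType.Exports.

Local Open Scope classical_set_scope.
Local Open Scope ring_scope.

Section duality.
Context {R : realType}.
Implicit Types mu nu : {measure set (measurableTypeR R) -> \bar R}.

Definition laplace mu (s : R) : \bar R :=
  (\int[mu]_x (expR (- (s * x)))%:E)%E.

Definition laplace_dom mu : set R := [set s | (laplace mu s < +oo)%E]°.

(* [fine] is harmless on the domain: there the transform is finite, and it is
   positive as soon as [mu] is nonzero. *)
Definition log_laplace mu (s : R) : R := ln (fine (laplace mu s)).

(* [laplace_dom mu] is open, so for [s] in it [mean_map mu s] only involves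
   values of [log_laplace mu] at points where the transform is finite. *)
Definition mean_map mu (s : R) : R := - derive1 (log_laplace mu) s.

Definition mean_domain mu : set R := mean_map mu @` laplace_dom mu.

(* The zero measure counts as concentrated on one point. *)
Definition concentrated_on_one_point mu : Prop :=
  exists a : R, mu (~` [set a]) = 0%E.

(* No local finiteness is required: it follows from the second clause. *)
Definition class_M mu : Prop :=
  ~ concentrated_on_one_point mu /\ laplace_dom mu !=set0.

Definition is_dual_measure mu nu : Prop :=
  [/\ class_M mu, class_M nu,
      mean_domain mu `<=` laplace_dom nu &
      forall s, laplace_dom mu s -> mean_map nu (mean_map mu s) = s].

End duality.

(* The generating function is taken at real arguments only; this already
   determines the masses. *)
Definition dilogarithm_distribution (R : realType)
    (mu : probability (measurableTypeR R) R) : Prop :=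
  (forall A : set (measurableTypeR R), measurable A ->
     mu A = \sum_(0 <= n <oo)
       mu [set (n%:R : R)] * \d_(n%:R : measurableTypeR R) A)%E /\
  (forall z : R, `|z| <= 1 ->
     \sum_(0 <= n < N) fine (mu [set (n%:R : R)]) * z ^+ n @[N --> \oo] -->
     expR (limn (fun N => \sum_(1 <= n < N) (z ^+ n - 1) / n%:R ^+ 2))).

(* Main.v *)
Require Import Defs.
From mathcomp Require Import all_boot all_order all_algebra.
From mathcomp Require Import all_classical all_reals all_analysis.
From mathcomp Require Import measurable_realfun.
From mathcomp Require Import ring lra.

(** At [z = expR (- s)] the generating function of [mu] is its Laplace
transform, so with [Li2 z] the sum of [z ^+ n / n ^+ 2] the log-Laplace
transform of [mu] at [s >= 0] is [Li2 (expR (- s)) - Li2 1]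
([laplace_dilogarithm]). Since [z * Li2' z = - ln (1 - z)], the chain rule
cancels the factor [z] and gives the mean map [s |-> - ln (1 - expR (- s))] on
the positive half-line ([mean_map_dilogarithm]). Now
[t = - ln (1 - expR (- s))] amounts to the symmetric relation
[expR (- s) + expR (- t) = 1], so this map is an involution of the positive
half-line ([dual_mapK]).

What remains is that the domain is exactly the positive half-line
([laplace_dom_dilogarithm]), that is, that the transform is infinite at every
negative point ([laplace_dilogarithm_pinfty]). Finiteness at a negative point
would give [mu] a finite first moment and make the transform Lipschitz at
[0+]; but its slope there is unbounded, because [- ln (1 - expR (- s))] is.

Finally, a measure carried by a point [a] has the constant [a] as its mean
map, and a constant is not an involution of the half-line; hence [mu] is in
the class of measures on which duality is defined. *)

Import Order.TTheory GRing.Theory Num.Theory.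
Import numFieldNormedType.Exports.

Local Open Scope classical_set_scope.
Local Open Scope ring_scope.

(** * The dilogarithm on the unit interval *)

Definition polylog_coef (R : realType) (k n : nat) : R := (n%:R ^+ k)^-1.

(** The term of index 0 is [0^-1 = 0], so this is the usual sum over
[n >= 1]. *)
Definition dilog {R : realType} (x : R) : R :=
  limn (pseries (polylog_coef R 2) x).

Lemma polylog_coef_ge0 (R : realType) k n : 0 <= polylog_coef R k n.
Proof. by rewrite invr_ge0 exprn_ge0. Qed.

(** With [r] the square root of [`|x|], the bound [n.+1%:R * r ^+ n <= (1 -
r)^-1] leaves a factor [r ^+ n] of [`|x| ^+ n = r ^+ n * r ^+ n], and so a
geometric majorant. Linear growth is what two formal derivatives of the
logarithmic series can reach, which is what termwise differentiation has to
control. *)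
Lemma is_cvg_pseries_linear {R : realType} (c : nat -> R) (x : R) :
  (forall n, 0 <= c n <= n.+1%:R) -> `|x| < 1 -> cvgn (pseries c x).
Proof.
move=> cn x1; set r := Num.sqrt `|x|.
have r0 : 0 <= r by exact: sqrtr_ge0.
have r1 : r < 1 by rewrite -sqrtr1 ltr_sqrt.
have xr : `|x| = r * r by rewrite -expr2 sqr_sqrtr.
have rn n : n.+1%:R * r ^+ n <= (1 - r)^-1.
  rewrite -[leRHS]mul1r ler_pdivlMr ?subr_gt0//.
  have H : n.+1%:R * r ^+ n <= \sum_(i < n.+1) r ^+ i.
    (* a decreasing sequence has partial sums above its last term repeated *)
    rewrite mulr_natl -[n.+1 in leLHS]card_ord -sumr_const.
    apply: ler_sum => i _.
    by apply: ler_wiXn2l => //; [exact: ltW | rewrite -ltnS].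
  have r10 : 0 <= 1 - r by rewrite subr_ge0 ltW.
  apply: (le_trans (ler_wpM2r r10 H)).
  by rewrite mulrC -opprB mulNr -subrX1 opprB gerBl exprn_ge0.
apply: normed_cvg; apply: (@series_le_cvg _ _ (geometric (1 - r)^-1 r)).
- by move=> n; exact: normr_ge0.
- by move=> n; rewrite /= mulr_ge0 ?exprn_ge0// invr_ge0 subr_ge0 ltW.
- move=> n /=; have /andP[c0 c1] := cn n.
  rewrite normrM normrX ger0_norm// xr exprMn mulrA ler_wpM2r ?exprn_ge0//.
  by apply: le_trans (rn n); rewrite ler_wpM2r ?exprn_ge0.
- by apply: is_cvg_geometric_series; rewrite ger0_norm.
Qed.

(** Telescoping: [1 / (m + 1) ^+ 2 <= 1 / m - 1 / (m + 1)] bounds the sum of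
[1 / n ^+ 2] over [1 <= n <= m] by [2 - 1 / m]. *)
Lemma is_cvg_dilog1 (R : realType) : cvgn (pseries (polylog_coef R 2) 1).
Proof.
apply: nondecreasing_is_cvgn.
  apply/nondecreasing_series => n _ _.
  by rewrite /= expr1n mulr1 polylog_coef_ge0.
exists 2 => _ [n _ <-] /=.
have H m : \sum_(0 <= i < m.+2) polylog_coef R 2 i * 1 ^+ i <= 2 - m.+1%:R^-1.
  elim: m => [|m IH].
    rewrite big_nat_recr// big_nat1 /polylog_coef !expr1n expr0n invr0 mul0r.
    rewrite invr1 /=; lra.
  rewrite big_nat_recr //= -[1 ^+ _]/(1 ^+ m.+2) expr1n mulr1.
  rewrite (le_trans (lerD IH (lexx _)))//.
  rewrite /polylog_coef -[m.+2]addn1 natrD.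
  have : (0 : R) < m.+1%:R by [].
  move: (m.+1%:R : R) => x x0.
  rewrite -subr_ge0 [leRHS](_ : _ = (x * (x + 1) ^+ 2)^-1).
    by rewrite invr_ge0 mulr_ge0 ?exprn_ge0 ?addr_ge0// ltW.
  by field; rewrite !gt_eqF// addr_gt0.
apply: (@le_trans _ _ (2 - n.+1%:R^-1)); last by rewrite gerBl invr_ge0.
apply: le_trans (H n); rewrite 2?big_nat_recr//= -addrA lerDl.
by rewrite addr_ge0// mulr_ge0 ?polylog_coef_ge0// expr1n.
Qed.

Lemma pseries_diffs_polylog_coef (R : realType) k n :
  pseries_diffs (polylog_coef R k.+1) n = (n.+1%:R ^+ k)^-1.
Proof. by rewrite /pseries_diffs /polylog_coef exprS invfM mulVKf. Qed.

Lemma limn_geometric {R : realType} (x : R) : `|x| < 1 ->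
  limn (pseries (fun=> 1) x) = (1 - x)^-1.
Proof.
move=> x1; rewrite -[RHS]mul1r; apply: cvg_lim => //.
exact: cvg_geometric_series.
Qed.

(** Both sides vanish at [0] and have derivative [1 / (1 - y)] on [[0, x]]: on
the left the coefficients [1 / n] become the geometric series. *)
Lemma log_series {R : realType} (x : R) : 0 <= x < 1 ->
  limn (pseries (polylog_coef R 1) x) = - ln (1 - x).
Proof.
move=> /andP[x0 x1]; pose f (y : R) := limn (pseries (polylog_coef R 1) y).
have df (y : R) : `|y| < 1 -> is_derive y 1 f (1 - y)^-1.
  move=> y1; rewrite -limn_geometric//; pose K := (1 + `|y|) / 2.
  have [K1 yK] : `|K| < 1 /\ `|y| < `|K|.
    by have := normr_ge0 y; rewrite /K => y0; rewrite ger0_norm; lra.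
  have d1 : pseries_diffs (polylog_coef R 1) = fun=> 1.
    by apply/funext => n; rewrite pseries_diffs_polylog_coef expr0 invr1.
  rewrite -d1; apply: pseries_snd_diffs yK; rewrite ?d1;
    apply: is_cvg_pseries_linear K1 => n.
  - rewrite polylog_coef_ge0/= /polylog_coef expr1.
    case: n => [|n]; first by rewrite invr0.
    by rewrite (@le_trans _ _ 1)// ?invf_le1// ler1n.
  - by rewrite ler01 ler1n.
  - by rewrite /pseries_diffs mulr1 ler0n lexx.
pose g y := f y + ln (1 - y).
have dg (y : R) : 0 <= y -> y <= x -> is_derive y 1 g 0.
  move=> y0 yx; have y1 : `|y| < 1 by rewrite ger0_norm// (le_lt_trans yx).
  have ? := df y y1.
  have y1' : 0 < 1 - y by lra.
  have dln : is_derive ((cst 1 - (@id R^o)) y) 1 (@ln R) (1 - y)^-1.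
    exact: is_derive1_ln.
  have d1y : is_derive y 1 (cst 1 - (@id R^o)) (0 - 1) by exact: is_deriveB.
  have dl : is_derive y 1 (@ln R \o (cst 1 - (@id R^o))) (- (1 - y)^-1).
    by have := is_derive1_comp dln d1y; rewrite sub0r mulrN1.
  rewrite -(subrr (1 - y)^-1); exact: (is_deriveD _ dl).
have dg' y : y \in `]0, x[%R -> is_derive y 1 g 0.
  by rewrite in_itv/= => /andP[/ltW y0 /ltW yx]; exact: dg.
have [|c _] := @MVT_segment R g (fun=> 0) 0 x x0 dg'.
  apply: derivable_within_continuous => y; rewrite in_itv/= => /andP[y0 yx].
  by have := dg y y0 yx; case.
rewrite mul0r /g subr0 ln1 addr0 => /eqP; rewrite subr_eq0 => /eqP fg.
apply/eqP; rewrite -addr_eq0 -/(f x) fg /f; apply/eqP.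
rewrite (_ : pseries _ _ = cst 0); first exact: lim_cst.
apply/funext => n; rewrite /pseries /series/= big1// => -[|i] _.
  by rewrite /polylog_coef expr1 invr0 mul0r.
by rewrite expr0n mulr0.
Qed.

(** Termwise, the derivative has coefficients [1 / (n + 1)]; multiplied by [x]
it is the logarithmic series. *)
Lemma is_derive_dilog {R : realType} (x : R) : 0 < x < 1 ->
  is_derive x 1 (@dilog R) (- ln (1 - x) / x).
Proof.
move=> /andP[x0 x1]; pose c n : R := n.+1%:R^-1.
have xc : `|x| < 1 by rewrite gtr0_norm.
have c_cvg (y : R) : `|y| < 1 -> cvgn (pseries c y).
  apply: is_cvg_pseries_linear => n.
  by rewrite invr_ge0 ler0n (@le_trans _ _ 1)// ?invf_le1// ler1n.
have -> : - ln (1 - x) / x = limn (pseries c x).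
  have x0' : x != 0 by rewrite gt_eqF.
  rewrite -log_series ?(ltW x0)// -[RHS](mulfK x0'); congr (_ / x).
  apply: cvg_lim => //; rewrite -cvg_shiftS/=.
  rewrite (_ : (fun n => _) = (fun n => pseries c x n * x)); last first.
    apply/funext => n; rewrite /pseries /series/= big_nat_recl//.
    rewrite /polylog_coef expr1 invr0 mul0r add0r mulr_suml.
    by apply: eq_bigr => i _; rewrite expr1 exprSr mulrA.
  by apply: cvgMr_tmp; exact: c_cvg.
pose K := (1 + x) / 2.
have [K1 xK] : `|K| < 1 /\ `|x| < `|K|.
  by rewrite /K !gtr0_norm; lra.
have d1 : pseries_diffs (polylog_coef R 2) = c.
  by apply/funext => n; rewrite pseries_diffs_polylog_coef.
rewrite -d1; apply: pseries_snd_diffs xK; rewrite ?d1.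
- apply: is_cvg_pseries_inside (is_cvg_dilog1 R) _; by rewrite normr1.
- exact: c_cvg.
- apply: is_cvg_pseries_linear K1 => n; rewrite /pseries_diffs divr_ge0//=.
  by rewrite ler_pdivrMr// -natrM ler_nat leq_pmulr.
Qed.

Lemma is_cvg_dilog {R : realType} (z : R) :
  `|z| <= 1 -> cvgn (pseries (polylog_coef R 2) z).
Proof.
move=> z1; apply: normed_cvg; apply: series_le_cvg (is_cvg_dilog1 R).
- by move=> n; exact: normr_ge0.
- by move=> n; rewrite /= mulr_ge0 ?polylog_coef_ge0 ?exprn_ge0.
- move=> n; rewrite /= normrM normrX ger0_norm ?polylog_coef_ge0//.
  by rewrite ler_wpM2l ?polylog_coef_ge0// expr1n exprn_ile1.
Qed.

Lemma dilog_le1 {R : realType} (z : R) : 0 <= z <= 1 -> dilog z <= dilog 1.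
Proof.
move=> /andP[z0 z1]; apply: ler_lim (is_cvg_dilog1 R) _.
  by apply: is_cvg_dilog; rewrite ger0_norm.
apply: nearW => N; apply: ler_sum => n _.
by rewrite ler_wpM2l ?polylog_coef_ge0// expr1n exprn_ile1.
Qed.

(** The exponent in the definition of the distribution: at [`|z| <= 1] the
series of [z ^+ n / n ^+ 2] and of [1 / n ^+ 2] converge separately. *)
Lemma dilog_exponent {R : realType} (z : R) : `|z| <= 1 ->
  limn (fun N => \sum_(1 <= n < N) (z ^+ n - 1) / n%:R ^+ 2) =
  dilog z - dilog 1.
Proof.
move=> z1; have cvg1 := is_cvg_dilog1 R; have cvgz := is_cvg_dilog z z1.
apply: cvg_lim => //; apply: cvg_trans; last exact: (cvgB cvgz cvg1).
apply: near_eq_cvg; near=> N.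
have N0 : (0 < N)%N by near: N; exact: nbhs_infty_gt.
rewrite !fctE /pseries /series/= -sumrB (big_ltn N0).
rewrite {1 2}/polylog_coef expr0n invr0 !mul0r subrr add0r.
by apply: eq_bigr => i _; rewrite /polylog_coef expr1n -mulrBr mulrC.
Unshelve. all: by end_near. Qed.

(** * The Laplace transform of the dilogarithm distribution *)

Lemma integral_atomic {R : realType} (a : nat -> R)
    (mu : probability (measurableTypeR R) R) (f : measurableTypeR R -> \bar R) :
  (forall A : set (measurableTypeR R), measurable A -> mu A =
     (\sum_(0 <= n <oo) mu [set a n] * \d_(a n : measurableTypeR R) A)%E) ->
  measurable_fun setT f ->
  (forall x, (0 <= f x)%E) ->
  (\int[mu]_x f x = \sum_(0 <= n <oo) mu [set a n] * f (a n))%E.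
Proof.
move=> muE mf f0.
pose k n : {nonneg R} := NngNum (fine_ge0 (measure_ge0 mu [set a n])).
have kE n : (k n)%:num%:E = mu [set a n].
  by rewrite /= fineK// fin_num_measure.
pose m n : {measure set (measurableTypeR R) -> \bar R} :=
  mscale (k n) (\d_(a n : measurableTypeR R)).
transitivity (\int[mseries m 0]_x f x)%E.
  apply: eq_measure_integral => A mA _; apply: (eq_trans (muE A mA)).
  by apply: eq_eseriesr => n _; rewrite -kE.
rewrite ge0_integral_measure_series//; apply: eq_eseriesr => n _.
by rewrite ge0_integral_mscale// integral_dirac// diracT mul1e kE.
Qed.

Lemma measurable_expR_scale {R : realType} (c : R) :
  measurable_fun setT
    (fun x : measurableTypeR R => (expR (- (c * x)))%:E : \bar R).
Proof.
apply/measurable_EFinP; apply: measurableT_comp => //.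
by apply: measurable_funN; exact: measurable_funM.
Qed.

Lemma laplace_dilogarithm {R : realType}
    (mu : probability (measurableTypeR R) R) (s : R) :
  dilogarithm_distribution mu -> 0 <= s ->
  laplace mu s = (expR (dilog (expR (- s)) - dilog 1))%:E.
Proof.
move=> [muE gf] s0; have z1 : `|expR (- s)| <= 1.
  by rewrite ger0_norm ?expR_ge0// -expR0 ler_expR oppr_le0.
apply: (eq_trans (integral_atomic (fun n => n%:R) mu _ muE
  (measurable_expR_scale s) (fun x => expR_ge0 _))).
rewrite -dilog_exponent//; apply: cvg_lim => //.
have sumE N : (\sum_(0 <= n < N) mu [set n%:R] * (expR (- (s * n%:R)))%:E =
    (\sum_(0 <= n < N) fine (mu [set n%:R]) * expR (- s) ^+ n)%:E)%E.
  rewrite -sumEFin; apply: eq_bigr => n _.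
  rewrite EFinM fineK ?fin_num_measure//; congr (_ * _%:E)%E.
  by rewrite -expRM_natr mulNr.
rewrite (eq_cvg _ _ sumE); apply: cvg_EFin; first exact: nearW.
exact: gf.
Qed.

(** * The mean map *)

Definition dual_map {R : realType} (s : R) : R := - ln (1 - expR (- s)).

Lemma expRN_itv {R : realType} (s : R) : 0 < s -> 0 < expR (- s) < 1.
Proof. by move=> s0; rewrite expR_gt0 -expR0 ltr_expR oppr_lt0. Qed.

Lemma dual_map_gt0 {R : realType} (s : R) : 0 < s -> 0 < dual_map s.
Proof.
move=> /expRN_itv/andP[e0 e1].
by rewrite oppr_gt0 ln_lt0// subr_gt0 e1 gtrBl.
Qed.

(** [t = dual_map s] means [expR (- s) + expR (- t) = 1], which is symmetric in
[s] and [t]. *)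
Lemma dual_mapK {R : realType} (s : R) :
  0 < s -> dual_map (dual_map s) = s.
Proof.
move=> /expRN_itv/andP[e0 e1].
by rewrite /dual_map opprK lnK ?posrE ?subr_gt0// subKr expRK opprK.
Qed.

Lemma is_derive_log_laplace_dilog {R : realType} (s : R) : 0 < s ->
  is_derive s 1 (fun t => dilog (expR (- t)) - dilog 1) (- dual_map s).
Proof.
move=> s0; have /andP[e0 e1] := expRN_itv s s0.
have de : is_derive s 1 (@expR R \o -%R) (- expR (- s)).
  rewrite -mulrN1; apply: is_derive1_comp.
have ddl : is_derive ((@expR R \o -%R) s) 1 (dilog)
    (- ln (1 - expR (- s)) / expR (- s)).
  by apply: is_derive_dilog; rewrite e0.
have -> : - dual_map s =
    - ln (1 - expR (- s)) / expR (- s) * (- expR (- s)) - 0.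
  by rewrite subr0 mulrN mulfVK ?gt_eqF.
exact: (is_deriveB (is_derive1_comp ddl de) (is_derive_cst _ _ _)).
Qed.

Lemma mean_map_dilogarithm {R : realType}
    (mu : probability (measurableTypeR R) R) (s : R) :
  dilogarithm_distribution mu -> 0 < s -> mean_map mu s = dual_map s.
Proof.
move=> hmu s0; rewrite /mean_map derive1E.
rewrite (@near_eq_derive _ _ _ _
  (fun t => dilog (expR (- t)) - dilog 1))//.
  by have := is_derive_log_laplace_dilog s s0 => ?; rewrite derive_val opprK.
near=> t; rewrite /log_laplace (laplace_dilogarithm mu) ?expRK//.
by apply: ltW; near: t; exact: lt_nbhsr.
Unshelve. all: by end_near. Qed.

(** * The domain of the Laplace transform *)

(** For every real [x], [1 <= expR (- (t * x)) + t * x] and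
[a * x <= expR (a * x)]; so [1 <= expR (- (t * x)) + (t / a) * expR (a * x)],
which is integrated. This is the finiteness of the first moment of [mu] in the
form of a bound on the slope at [0]. *)
Lemma laplace_linear_bound {R : realType}
    (mu : probability (measurableTypeR R) R) (a : R) :
  0 < a -> (laplace mu (- a) < +oo)%E ->
  exists C : R, forall t, 0 < t -> (1 <= laplace mu t + (t * C)%:E)%E.
Proof.
move=> a0 fin; have L0 s : (0 <= laplace mu s)%E.
  by apply: integral_ge0 => x _; rewrite lee_fin expR_ge0.
exists (a^-1 * fine (laplace mu (- a))) => t t0.
rewrite mulrA EFinM fineK; last by rewrite ge0_fin_numE.
rewrite -(probability_setT mu) -[leLHS]mul1e -integral_cst//.
have ta0 : 0 <= t / a by rewrite divr_ge0// ltW.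
have mL (c : R) := measurable_expR_scale c.
rewrite /laplace -ge0_integralZl_EFin//.
have mM := measurable_funeM (t / a)%:E (mL (- a)).
rewrite -ge0_integralD//; last first.
  by move=> x _; rewrite lee_fin mulr_ge0// expR_ge0.
apply: ge0_le_integral => //; first exact: emeasurable_funD (mL t) mM.
move=> x _; rewrite lee_fin mulNr opprK.
have /(ler_wpM2l ta0) := expR_ge1Dx (a * x).
have := expR_ge1Dx (- (t * x)).
rewrite [t / a * (1 + _)](_ : _ = t / a + t * x); last by field; rewrite gt_eqF.
lra.
Qed.

(** Makes the mean map unbounded near [0], since [1 - expR (- s) <= s]. *)
Lemma dual_map_ge_Nln {R : realType} (s : R) : 0 < s -> - ln s <= dual_map s.
Proof.
move=> s0; have /andP[_ e1] := expRN_itv s s0.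
rewrite /dual_map lerN2 ler_ln ?posrE ?subr_gt0//.
by have := expR_ge1Dx (- s); lra.
Qed.

(** The transform [F] satisfies [1 - t * C <= F t <= 1]. On [[r / 2, r]] the
mean value theorem gives a point [x] where
[F x * dual_map x * (r / 2) = F (r / 2) - F r <= r * C], while
[dual_map x >= - ln r] is large when [r] is small: a contradiction. Working on
[[r / 2, r]] instead of [[0, r]] avoids the continuity of [F] at [0]. *)
Lemma laplace_dilogarithm_pinfty {R : realType}
    (mu : probability (measurableTypeR R) R) (a : R) :
  dilogarithm_distribution mu -> 0 < a -> ~ (laplace mu (- a) < +oo)%E.
Proof.
move=> hmu a0 /(laplace_linear_bound mu a a0)[C bound].
pose F (t : R) := expR (dilog (expR (- t)) - dilog 1).
have Fge (t : R) : 0 < t -> 1 - t * C <= F t.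
  move=> t0; have := bound _ t0.
  by rewrite (laplace_dilogarithm mu _ hmu (ltW t0)) -EFinD lee_fin lerBlDr.
have Fle1 (t : R) : 0 < t -> F t <= 1.
  move=> /expRN_itv/andP[/ltW e0 /ltW e1].
  by rewrite -expR0 ler_expR subr_le0 dilog_le1// e0.
have dF (t : R) : 0 < t -> is_derive t 1 F (F t * - dual_map t).
  move=> t0; have dG := is_derive_log_laplace_dilog t t0.
  exact: (@is_derive1_comp _ expR _ _ _ _ (is_derive_expR _) dG).
pose D := `|C|; have D0 : 0 <= D by exact: normr_ge0.
have CD : C <= D by exact: ler_norm.
(* so small that [1 - r * C >= 1 / 2] and [- ln r > 4 * C] *)
pose r := expR (- (4 * D + 1)); have r0 : 0 < r by exact: expR_gt0.
have rD : r * D <= 2^-1.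
  have := expR_ge1Dx (4 * D + 1); rewrite -(ler_pM2l r0).
  rewrite -expRD addNr expR0; nra.
have rr : r / 2 < r by lra.
have dF' (t : R) : t \in `]r / 2, r[ -> is_derive t 1 F (F t * - dual_map t).
  by rewrite in_itv/= => /andP[t0 _]; apply: dF; lra.
have [|x xr] := MVT rr dF'.
  apply: derivable_within_continuous => t; rewrite in_itv/= => /andP[t0 _].
  by have [] := dF t ltac:(lra).
move: xr; rewrite in_itv/= => /andP[rx xr].
have x0 : 0 < x by lra.
have lnx : 4 * D + 1 <= dual_map x.
  apply: le_trans (dual_map_ge_Nln x x0).
  by rewrite lerNr -ler_expR lnK ?posrE// ltW.
have := Fge _ x0; have := Fge _ r0; have := Fle1 (r / 2) ltac:(lra).
move: (F x) (F r) (F (r / 2)) => Fx Fr Fr2 h1 h2 h3 h4.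
have h5 : 2^-1 <= Fx by nra.
have h6 : (4 * D + 1) / 2 <= Fx * dual_map x by nra.
nra.
Qed.

Lemma laplace_dom_dilogarithm {R : realType}
    (mu : probability (measurableTypeR R) R) :
  dilogarithm_distribution mu -> laplace_dom mu = [set s | 0 < s].
Proof.
move=> hmu; apply/seteqP; split=> s /=.
  rewrite /laplace_dom /interior/= => /nbhs_ballP[e /= e0 sub].
  rewrite ltNge; apply/negP => s0.
  have es : 0 < e / 2 - s by lra.
  apply: (laplace_dilogarithm_pinfty mu _ hmu es).
  apply: sub; rewrite /ball/= opprB opprB addrCA subrr addr0 ger0_norm; lra.
move=> s0; apply: filterS (lt_nbhsr s0) => t t0 /=.
by rewrite (laplace_dilogarithm mu _ hmu (ltW t0)) ltry.
Qed.

(** * Self-duality *)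

(** The transform is then [expR (- (t * a))], whose logarithm is linear in
[t]. *)
Lemma mean_map_concentrated {R : realType}
    (mu : probability (measurableTypeR R) R) (a s : R) :
  mu (~` [set a]) = 0%E -> mean_map mu s = a.
Proof.
move=> mu0; have L t : laplace mu t = (expR (- (t * a)))%:E.
  transitivity (\int[mu]_x cst (expR (- (t * a)))%:E x)%E.
    apply: ge0_ae_eq_integral => //; first exact: (measurable_expR_scale t).
      by move=> x _; rewrite lee_fin expR_ge0.
    exists (~` [set a]); split => //.
      exact: (measurableC (measurable_set1 a)).
    by move=> x; apply: contra_not => -> _.
  rewrite integral_cst//.
  by rewrite [X in (_ * X)%E](probability_setT mu) mule1.
have dL : is_derive s 1 (- a *: (@id R^o)) (- a *: 1) by exact: is_deriveZ.
have logL : log_laplace mu = - a *: (@id R^o).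
  by apply/funext => t; rewrite /log_laplace L expRK mulrC -mulNr.
rewrite /mean_map logL derive1E derive_val.
by rewrite -[RHS]opprK -[- a in RHS]mulr1.
Qed.

Theorem proposition8 (R : realType) (mu : probability (measurableTypeR R) R)
    (hmu : dilogarithm_distribution mu) :
  is_dual_measure mu mu.
Proof.
have mean (s : R) : 0 < s -> mean_map mu s = dual_map s.
  exact: mean_map_dilogarithm.
have domE := laplace_dom_dilogarithm mu hmu.
have muM : class_M mu.
  split; last by exists 1; rewrite domE /= ltr01.
  (* [a] would be the value of the mean map everywhere, so that applying the
     involution to [a] would have to return every positive number *)
  move=> [a /mean_map_concentrated mua].
  have dual_a s : 0 < s -> dual_map a = s.
    by move=> s0; rewrite -(mua s) mean// dual_mapK.
  by have := dual_a 1 ltr01; rewrite (dual_a 2)//; lra.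
split => //.
- rewrite /mean_domain domE => _ [s /= s0 <-].
  by rewrite mean//; exact: dual_map_gt0.
- rewrite domE => s /= s0.
  by rewrite (mean _ s0) mean ?dual_mapK//; exact: dual_map_gt0.
Qed.
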